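(* Let $n$ be a positive integer and let $$\psi(x)=\sum_{\pi\in\mathfrak{B}_n}\binom{x+n-\operatorname{ades}(\pi)}{n}\,\pi,$$ a polynomial in $x$ with coefficients in the group algebra $\mathbb{Q}[\mathfrak{B}_n]$ of the hyperoctahedral group. Then, as polynomials in $x$ and $y$ with coefficients in $\mathbb{Q}[\mathfrak{B}_n]$, $$\psi(x)\psi(y)=\psi(2xy),$$ or, upon substituting $x\leftarrow x/2$ and $y\leftarrow y/2$, $$\psi(x/2)\psi(y/2)=\psi(xy/2).$$
   Context: $\mathfrak{B}_n$ is the hyperoctahedral group: the group, under composition $(\sigma\tau)(s)=\sigma(\tau(s))$, of all bijections $\pi$ of $\{-n,\ldots,-1,0,1,\ldots,n\}$ with $\pi(-s)=-\pi(s)$ for $s=0,1,\ldots,n$ (so $\pi(0)=0$). An element $\pi\in\mathfrak{B}_n$ has an augmented descent at position $i\in\{0,1,\ldots,n\}$ if $0\le i\le n-1$ and $\pi(i)>\pi(i+1)$, or if $i=n$ and $\pi(n)>0$. The augmented descent number $\operatorname{ades}(\pi)$ is the number of augmented descents of $\pi$. For a polynomial $p$, $\binom{p}{n}=\frac{p(p-1)\cdots(p-n+1)}{n!}$. The variables $x,y$ are commuting indeterminates that also commute with the elements of the group algebra. *)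

(* Defs.v *)
From HB Require Import structures.
From mathcomp Require Import all_boot all_order all_fingroup all_algebra.

Set Implicit Arguments.
Unset Strict Implicit.
Unset Printing Implicit Defensive.

Import Order.TTheory GRing.Theory Num.Theory.
Local Open Scope ring_scope.

(* The integers -n, ..., n are encoded by the 2n + 1 ordinals below
   n.*2.+1: the ordinal k stands for the integer k - n. *)
Definition spt (n : nat) := 'I_n.*2.+1.

Definition sint (n : nat) (s : spt n) : int := (s : nat)%:Z - n%:Z.

Definition sopp (n : nat) (s : spt n) : spt n := rev_ord s.

(* Meaningful only for i <= n. *)
Definition snat (n i : nat) : spt n := inord (n + i).

Lemma sint_inj n : injective (@sint n).
Proof. by move=> s t /addIr[/val_inj]. Qed.

Lemma sint_opp n (s : spt n) : sint (sopp s) = - sint s.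
Proof.
have le_s : (s <= n.*2)%N by rewrite -ltnS.
have Es : (sopp s : nat) = (n.*2 - s)%N by rewrite /= subSS.
rewrite /sint Es; move: (s : nat) le_s => k le_k.
by rewrite -subzn // -addnn PoszD opprB addrAC addrK.
Qed.

Lemma sint_nat n i : (i <= n)%N -> sint (snat n i) = i%:Z.
Proof.
move=> le_in; rewrite /sint /snat inordK; first by rewrite PoszD addrC addKr.
by rewrite ltnS -addnn leq_add2l.
Qed.

Definition is_signed (n : nat) (p : {perm spt n}) : bool :=
  [forall s, p (sopp s) == sopp (p s)].

Record hyperoct (n : nat) := Hyperoct {
  hperm :> {perm spt n};
  hpermP : is_signed hperm
}.

HB.instance Definition _ n := [isSub for @hperm n].
HB.instance Definition _ n := [Finite of hyperoct n by <:].

Section HyperoctGroup.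
Variable n : nat.
Implicit Types p q : hyperoct n.

Fact hone_subproof : is_signed (1%g : {perm spt n}).
Proof. by apply/forallP => s; rewrite !perm1. Qed.

(* Permutations in MathComp compose from left to right, so the group law
   (p q)(s) = p (q s) is the converse of the one on {perm spt n}. *)
Fact hmul_subproof p q : is_signed (hperm q * hperm p)%g.
Proof.
apply/forallP => s; rewrite !permM.
by rewrite (eqP (forallP (hpermP q) s)) (eqP (forallP (hpermP p) _)).
Qed.

Fact hinv_subproof p : is_signed (hperm p)^-1%g.
Proof.
apply/forallP => s; apply/eqP/(@perm_inj _ p).
by rewrite (eqP (forallP (hpermP p) _)) !permKV.
Qed.

Definition hone := Hyperoct hone_subproof.
Definition hmul p q := Hyperoct (hmul_subproof p q).
Definition hinv p := Hyperoct (hinv_subproof p).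

Fact hmulA : associative hmul.
Proof. by move=> p q r; apply: val_inj; rewrite /= mulgA. Qed.

Fact hmul1 : left_id hone hmul.
Proof. by move=> p; apply: val_inj; rewrite /= mulg1. Qed.

Fact hmulV : left_inverse hone hinv hmul.
Proof. by move=> p; apply: val_inj; rewrite /= mulgV. Qed.

HB.instance Definition _ :=
  Finite_isGroup.Build (hyperoct n) hmulA hmul1 hmulV.

Lemma hmulE p q s : (p * q)%g s = p (q s).
Proof. by rewrite permM. Qed.

End HyperoctGroup.

Definition is_ades (n : nat) (p : hyperoct n) (i : nat) : bool :=
  if (i < n)%N then sint (p (snat n i.+1)) < sint (p (snat n i))
  else 0 < sint (p (snat n n)).

Definition ades (n : nat) (p : hyperoct n) : nat :=
  #|[set i : 'I_n.+1 | is_ades p i]|.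

(* The group algebra R[gT], with convolution product.  It is an alias of
   {ffun gT -> R} so as not to inherit the pointwise ring structure. *)
Definition galg (R : comNzRingType) (gT : finGroupType) : Type :=
  {ffun gT -> R}.

HB.instance Definition _ (R : comNzRingType) (gT : finGroupType) :=
  GRing.Lmodule.copy (galg R gT) {ffun gT -> R^o}.

Section GroupAlgebra.
Variables (R : comNzRingType) (gT : finGroupType).
Implicit Types a b c : galg R gT.

Definition gcoef (a : galg R gT) (g : gT) : R := (a : {ffun gT -> R}) g.

Definition gbase (g : gT) : galg R gT := [ffun h => (h == g)%:R].

Definition gmul a b : galg R gT :=
  [ffun g => \sum_(h : gT) gcoef a h * gcoef b (h^-1 * g)%g].

Lemma galgP a b : gcoef a =1 gcoef b <-> a = b.
Proof. by split=> [/ffunP|->]. Qed.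

Lemma gcoefD a b g : gcoef (a + b) g = gcoef a g + gcoef b g.
Proof. by rewrite /gcoef ffunE. Qed.

Lemma gcoefZ (k : R) a g : gcoef (k *: a) g = k * gcoef a g.
Proof. by rewrite /gcoef ffunE. Qed.

Lemma gcoef0 g : gcoef 0 g = 0.
Proof. by rewrite /gcoef ffunE. Qed.

Lemma gcoef_base h g : gcoef (gbase h) g = (g == h)%:R.
Proof. by rewrite /gcoef ffunE. Qed.

Lemma gcoef_mul a b g :
  gcoef (gmul a b) g = \sum_(h : gT) gcoef a h * gcoef b (h^-1 * g)%g.
Proof. by rewrite /gcoef ffunE. Qed.

Fact gmulA : associative gmul.
Proof.
move=> a b c; apply/galgP => g; rewrite !gcoef_mul.
under eq_bigr do rewrite gcoef_mul big_distrr.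
under [RHS]eq_bigr do rewrite gcoef_mul big_distrl.
rewrite [RHS]exchange_big; apply: eq_bigr => h _ /=.
rewrite [RHS](reindex_inj (mulgI h)); apply: eq_bigr => k _ /=.
by rewrite mulKg invMg -!mulgA mulrA.
Qed.

Fact gmul1 : left_id (gbase 1) gmul.
Proof.
move=> a; apply/galgP => g; rewrite gcoef_mul (bigD1 1%g) //= big1 => [|h].
  by rewrite gcoef_base eqxx mul1r invg1 mul1g addr0.
by move=> /negPf h1; rewrite gcoef_base h1 mul0r.
Qed.

Fact gmulr1 : right_id (gbase 1) gmul.
Proof.
move=> a; apply/galgP => g; rewrite gcoef_mul (bigD1 g) //= big1 => [|h hg].
  by rewrite gcoef_base mulVg eqxx mulr1 addr0.
by rewrite gcoef_base -eq_mulVg1 (negPf hg) mulr0.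
Qed.

Fact gmulDl : left_distributive gmul +%R.
Proof.
move=> a b c; apply/galgP => g; rewrite gcoefD !gcoef_mul -big_split.
by apply: eq_bigr => h _; rewrite gcoefD mulrDl.
Qed.

Fact gmulDr : right_distributive gmul +%R.
Proof.
move=> a b c; apply/galgP => g; rewrite gcoefD !gcoef_mul -big_split.
by apply: eq_bigr => h _; rewrite gcoefD mulrDr.
Qed.

Fact gone_neq0 : gbase 1 != 0.
Proof.
apply/eqP => /galgP/(_ 1%g)/eqP.
by rewrite gcoef_base gcoef0 eqxx oner_eq0.
Qed.

HB.instance Definition _ := GRing.Zmodule_isNzRing.Build (galg R gT)
  gmulA gmul1 gmulr1 gmulDl gmulDr gone_neq0.

Fact gscaleAl (k : R) a b : k *: (a * b) = (k *: a) * b.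
Proof.
apply/galgP => g; rewrite gcoefZ !gcoef_mul big_distrr.
by apply: eq_bigr => h _; rewrite /= gcoefZ mulrA.
Qed.

HB.instance Definition _ :=
  GRing.Lmodule_isLalgebra.Build R (galg R gT) gscaleAl.

Fact gscaleAr (k : R) a b : k *: (a * b) = a * (k *: b).
Proof.
apply/galgP => g; rewrite gcoefZ !gcoef_mul big_distrr.
by apply: eq_bigr => h _; rewrite /= gcoefZ mulrCA.
Qed.

HB.instance Definition _ :=
  GRing.Lalgebra_isAlgebra.Build R (galg R gT) gscaleAr.

Lemma gbaseM (g h : gT) : gbase (g * h)%g = gbase g * gbase h.
Proof.
apply/galgP => k; rewrite gcoef_mul (bigD1 g) //= big1 => [|l /negPf lg].
  rewrite !gcoef_base eqxx mul1r addr0.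
  by rewrite (can2_eq (mulKVg g) (mulKg g)).
by rewrite gcoef_base lg mul0r.
Qed.

End GroupAlgebra.

Notation QB n := (galg rat (hyperoct n)).

Definition pbinom (p : {poly rat}) (n : nat) : {poly rat} :=
  (n`!%:R)^-1 *: \prod_(i < n) (p - i%:R).

Definition psi (n : nat) : {poly QB n} :=
  \sum_(p : hyperoct n)
    map_poly (in_alg (QB n)) (pbinom ('X + n%:R - (ades p)%:R) n)
    * (gbase rat p)%:P.

(* In {poly {poly QB n}} the variable x is 'X%:P and y is 'X.  The two
   variables commute with each other and with the coefficients. *)
Definition psi_at (n : nat) (t : {poly {poly QB n}}) : {poly {poly QB n}} :=
  ((psi n)^:P^:P).[t].

(* Main.v *)
(* For a positive integer k, psi(k) is the sum, over the (2k)^n odd functions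
   F on {-n, ..., n} with values in [-k, k) on 1, ..., n, of the unique signed
   permutation that sorts {-n, ..., n} by (F(s), s) lexicographically: the F
   sorted by p are the augmented P-partitions of p, and adding j - 1 minus the
   number of descents before position j to F(p(j)) turns them into strictly
   increasing sequences below k + n - ades(p).

   If f is sorted by F and g by G, then f g sorts by (G(f^-1(s)), F(s), s),
   hence by (2k G(f^-1(s)) + F(s), s).  By division with remainder by 2k this
   exhausts the functions for 2kl, so psi(k) psi(l) = psi(2kl).  The polynomial
   identities follow by evaluation at all positive even integers; evenness
   takes care of the substitution x <- x/2. *)

Require Import Defs.
From mathcomp Require Import all_boot all_order all_fingroup all_algebra.
From mathcomp Require Import zify.
Import Order.TTheory GRing.Theory Num.Theory.
Set Implicit Arguments.
Unset Strict Implicit.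
Unset Printing Implicit Defensive.
Local Open Scope ring_scope.

(** * Counting along a one-to-one relation *)

Lemma card_eq_rel (S T : finType) (A : {set S}) (B : {set T}) (r : S -> T -> Prop) :
    (forall x, x \in A -> exists2 y, y \in B & r x y) ->
    (forall y, y \in B -> exists2 x, x \in A & r x y) ->
    (forall x y y', r x y -> r x y' -> y = y') ->
    (forall x x' y, r x y -> r x' y -> x = x') ->
  #|A| = #|B|.
Proof.
move=> rAB rBA r_fun r_inj.
suff half (S' T' : finType) (C : {set S'}) (D : {set T'}) (q : S' -> T' -> Prop) :
    (forall x, x \in C -> exists2 y, y \in D & q x y) ->
    (forall x x' y, q x y -> q x' y -> x = x') -> (#|C| <= #|D|)%N.
  apply/eqP; rewrite eqn_leq (half _ _ A B r) //=.
  by apply: (half _ _ B A (fun y x => r x y)) => // y y' x; apply: r_fun.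
move=> qCD q_inj.
(* [None] serves the points outside [C], since [T'] may be empty. *)
have /fin_all_exists[f fP] (x : S') : exists o : option T',
    x \in C -> exists y, [/\ o = Some y, y \in D & q x y].
  case: (boolP (x \in C)) => [/qCD[y Dy qxy]|]; last by exists None.
  by exists (Some y) => _; exists y.
have f_inj : {in C &, injective f}.
  move=> x x' Cx Cx' fxx'.
  have [y [fx _ qxy]] := fP x Cx; have [y' [fx' _ qxy']] := fP x' Cx'.
  apply: q_inj qxy _; suff -> : y = y' by [].
  by apply: Some_inj; rewrite -fx -fx'.
rewrite -(card_in_imset f_inj) -(card_imset D (@Some_inj _)).
apply/subset_leq_card/subsetP => _ /imsetP[x Cx ->].
have [y [-> Dy _]] := fP x Cx; exact: imset_f.
Qed.

(** * Sorting the signed points by an odd function *)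

Section Sorting.

Variable n : nat.
Implicit Types (s t u v : spt n) (F G : spt n -> int) (p q : hyperoct n).

Lemma val_sopp s : sopp s = (n.*2 - s)%N :> nat.
Proof. by rewrite /= subSS. Qed.

Lemma soppK : involutive (@sopp n).
Proof. exact: rev_ordK. Qed.

Lemma val_snat i : (i <= n)%N -> snat n i = (n + i)%N :> nat.
Proof. by move=> le_in; rewrite /snat inordK //; lia. Qed.

Lemma sopp_snat0 : sopp (snat n 0) = snat n 0.
Proof. by apply: ord_inj; rewrite val_sopp val_snat //; lia. Qed.

Lemma hyperoct_opp p s : p (sopp s) = sopp (p s).
Proof. exact/eqP/(forallP (hpermP p)). Qed.

Lemma hyperoct_snat0 p : p (snat n 0) = snat n 0.
Proof.
apply: ord_inj; have := congr1 (@nat_of_ord _) (hyperoct_opp p (snat n 0)).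
rewrite sopp_snat0.
rewrite val_sopp val_snat //; have := ltn_ord (p (snat n 0)); rewrite /=; lia.
Qed.

Lemma hyperoctVK p : cancel (p^-1)%g p.
Proof. by move=> s; rewrite -hmulE mulgV perm1. Qed.

Lemma hyperoctKV p : cancel p (p^-1)%g.
Proof. by move=> s; rewrite -hmulE mulVg perm1. Qed.

Lemma spt_cases s :
  (exists2 j, (j <= n)%N & s = snat n j) \/
  (exists2 j, (j < n)%N & s = sopp (snat n j.+1)).
Proof.
have lt_s := ltn_ord s; have [le_ns|lt_sn] := leqP n s.
  left; exists (s - n)%N; first by lia.
  by apply: ord_inj; rewrite val_snat /=; lia.
right; exists (n - s.+1)%N; first by lia.
by apply: ord_inj; rewrite val_sopp val_snat /=; lia.
Qed.

Definition odd_fun F := forall s, F (sopp s) = - F s.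

Lemma odd_fun0 F : odd_fun F -> F (snat n 0) = 0.
Proof.
move=> /(_ (snat n 0)).
rewrite sopp_snat0.
lia.
Qed.

Lemma odd_fun_eq F G : odd_fun F -> odd_fun G ->
  (forall j, (j < n)%N -> F (snat n j.+1) = G (snat n j.+1)) -> F =1 G.
Proof.
move=> Fodd Godd FG s; case: (spt_cases s) => [[[|j] lt_jn ->]|[j lt_jn ->]].
- by rewrite !odd_fun0.
- exact: FG.
- by rewrite Fodd Godd FG.
Qed.

Definition klt F s t := (F s < F t) || ((F s == F t) && (s < t)%N).

Lemma klt_trans F : transitive (klt F).
Proof. by move=> t s u; rewrite /klt; lia. Qed.

Lemma klt_irr F : irreflexive (klt F).
Proof. by move=> s; rewrite /klt; lia. Qed.

Lemma klt_total F s t : s != t -> klt F s t || klt F t s.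
Proof. by rewrite -val_eqE /klt /=; lia. Qed.

Lemma klt_opp F s t : odd_fun F -> klt F (sopp s) (sopp t) = klt F t s.
Proof.
move=> Fodd; rewrite /klt !Fodd !val_sopp.
by have := ltn_ord s; have := ltn_ord t; lia.
Qed.

Definition sorts F p := [forall s : spt n, forall t : spt n, (s < t)%N ==> klt F (p s) (p t)].

Lemma sortsP F p :
  reflect (forall s t : spt n, (s < t)%N -> klt F (p s) (p t)) (sorts F p).
Proof.
apply: (iffP 'forall_'forall_implyP) => H s t; exact: H.
Qed.

(** Negation reverses [klt F], so the chain over 0, ..., n reflects to the negative positions, and
    the two halves meet at 0. *)
Lemma sorts_nat F p : odd_fun F ->
    (forall i, (i < n)%N -> klt F (p (snat n i)) (p (snat n i.+1))) ->
  sorts F p.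
Proof.
move=> Fodd Fp.
have Fpos i j : (i < j)%N -> (j <= n)%N -> klt F (p (snat n i)) (p (snat n j)).
  elim: j => // j IHj; rewrite ltnS leq_eqVlt => /orP[/eqP-> /Fp//|lt_ij le_jn].
  by apply: klt_trans (Fp _ le_jn); apply: IHj; lia.
apply/sortsP => s t.
case: (spt_cases s) => [[i le_in ->]|[i lt_in ->]];
  case: (spt_cases t) => [[j le_jn ->]|[j lt_jn ->]].
- by rewrite !val_snat // => ?; apply: Fpos; lia.
- by rewrite val_sopp !val_snat //; lia.
- move=> _; have negF : klt F (p (sopp (snat n i.+1))) (p (snat n 0)).
    by rewrite -[X in klt _ _ (p X)]sopp_snat0 !hyperoct_opp klt_opp // Fpos.
  by case: j le_jn => // j le_jn; apply: klt_trans negF _; apply: Fpos.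
- rewrite !val_sopp !val_snat // !hyperoct_opp klt_opp // => ?.
  by apply: Fpos => //; lia.
Qed.

(** The point placed at [s] has exactly [s] predecessors for [klt F], so [F] alone determines it. *)
Lemma sorts_uniq F p q : sorts F p -> sorts F q -> p = q.
Proof.
suff rankP r : sorts F r -> forall s, #|[set t | klt F t (r s)]| = s :> nat.
  move=> Fp Fq; apply/val_inj/permP => s.
  rewrite -[LHS](hyperoctVK q); congr (q _); apply: ord_inj.
  by rewrite /= -(rankP _ Fq) (hyperoctVK q) (rankP _ Fp).
move=> Fr s.
have -> : [set t | klt F t (r s)] = r @: [set t : spt n | (t < s)%N].
  apply/setP => t; rewrite -{1 2}(hyperoctVK r t) mem_imset ?inE; last exact: perm_inj.
  set u := (r^-1)%g t; have [/(sortsP _ _ Fr)//|lt_su|/val_inj->] := ltngtP u s.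
    apply/negP => us; have := klt_trans us (sortsP _ _ Fr _ _ lt_su).
    by rewrite klt_irr.
  by rewrite klt_irr.
rewrite card_imset; last exact: perm_inj.
rewrite -sum1_card (eq_bigl (fun t : 'I_n.*2.+1 => (t < s)%N)) => [|t]; last by rewrite inE.
by rewrite -(big_ord_widen _ (fun=> 1%N)) ?sum1_card ?card_ord // ltnW.
Qed.

(** Counting the predecessors of each point is injective because [klt F] is total; the inverse of
    the resulting permutation sorts. *)
Lemma sorts_exists F : odd_fun F -> exists p, sorts F p.
Proof.
move=> Fodd; pose before s := [set t | klt F t s].
have lt_before s : (#|before s| < n.*2.+1)%N.
  rewrite -[X in (_ < X)%N]card_ord -cardsT; apply: proper_card.
  by rewrite properT; apply/eqP => /setP/(_ s); rewrite !inE klt_irr.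
pose rank s : spt n := Ordinal (lt_before s).
have rank_mono s t : klt F s t -> (rank s < rank t)%N.
  move=> st; apply: proper_card; apply/properP; split.
    by apply/subsetP => u; rewrite !inE => /klt_trans; apply.
  by exists s; rewrite !inE ?klt_irr.
have rank_inj : injective rank.
  move=> s t; apply: contra_eq => /(klt_total F)/orP[] /rank_mono; rewrite -val_eqE /=; lia.
have rank_opp s : rank (sopp s) = sopp (rank s).
  apply: ord_inj; rewrite val_sopp /=.
  have -> : before (sopp s) = (@sopp n) @: [set t | klt F s t].
    apply/setP => t; rewrite -[t]soppK mem_imset; last exact: (can_inj soppK).
    by rewrite !inE klt_opp.
  rewrite card_imset; last exact: (can_inj soppK).
  (* Predecessors, [s] and successors partition the 2n + 1 points. Negation turns successors into
     predecessors, so the ranks of opposite points add up to [n.*2]. *)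
  have E : [set: spt n] = s |: (before s :|: [set t | klt F s t]).
    apply/setP => t; rewrite !inE; case: eqVneq => //= /(klt_total F); by rewrite orbC.
  have := congr1 (fun A : {set spt n} => #|A|) E.
  rewrite cardsT card_ord cardsU1 !inE !klt_irr /= cardsU.
  have -> : before s :&: [set t | klt F s t] = set0.
    apply/setP => t; rewrite !inE; apply/negP => /andP[ts /(klt_trans ts)].
    by rewrite klt_irr.
  rewrite cards0; set a := #|before s|; set b := #|_|; lia.
have rank_signed : is_signed (perm rank_inj).
  by apply/forallP => s; rewrite !permE rank_opp.
exists (Hyperoct rank_signed)^-1%g; apply/sortsP => s t.
set p := Hyperoct rank_signed.
have rankV u : rank ((p^-1)%g u) = u by rewrite -[RHS](hyperoctVK p) [in RHS]permE.
apply: contraTT => nst; have [->|ne_st] := eqVneq s t; first by rewrite ltnn.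
have := klt_total F (s := (p^-1)%g s) (t := (p^-1)%g t).
rewrite (inj_eq perm_inj) => /(_ ne_st); rewrite (negPf nst) => /rank_mono.
by rewrite !rankV -leqNgt => /ltnW.
Qed.

End Sorting.

(** * Words as odd functions, and their sorting permutations *)

Section Words.

Variable n : nat.
Implicit Types (s t u v : spt n) (F G : spt n -> int) (p q : hyperoct n).

(** Index [j] of [a] holds the value at the integer j + 1. *)
Definition oddext (a : nat -> int) s : int :=
  if (n < s)%N then a (s - n.+1)%N else if (s < n)%N then - a (n - s.+1)%N else 0.

Lemma oddext_odd a : odd_fun (oddext a).
Proof.
move=> s; rewrite /oddext val_sopp; have := ltn_ord s.
case: (ltngtP s n) => [lt_sn|lt_ns|->] lt_s.
- have -> : (n < n.*2 - s)%N by lia.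
  by rewrite opprK; congr (a _); lia.
- have -> : (n < n.*2 - s)%N = false by lia.
  have -> : (n.*2 - s < n)%N by lia.
  by congr (- a _); lia.
- have -> : (n.*2 - n)%N = n by lia.
  by rewrite ltnn oppr0.
Qed.

Lemma oddext_snat a j : (j < n)%N -> oddext a (snat n j.+1) = a j.
Proof.
move=> lt_jn; rewrite /oddext val_snat //.
have -> : (n < n + j.+1)%N by lia.
by congr (a _); lia.
Qed.

(* By oddness, -k < F s <= k when s stands for a negative integer. *)
Definition bounded (k : nat) F :=
  forall s : spt n, (n < s)%N -> - k%:Z <= F s < k%:Z.

Definition word k := {ffun 'I_n -> 'I_k.*2}.

(** Shifting the letters by k gives values in [-k, k). The default 0 is never reached: [oddext]
    reads only indices below n. *)
Definition lab k (w : word k) : spt n -> int :=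
  oddext (fun j => oapp (fun i => (w i)%:Z - k%:Z) 0 (insub j)).

Lemma lab_odd k (w : word k) : odd_fun (lab w).
Proof. exact: oddext_odd. Qed.

Lemma lab_snat k (w : word k) (i : 'I_n) : lab w (snat n i.+1) = (w i)%:Z - k%:Z.
Proof. by rewrite /lab oddext_snat // valK. Qed.

Lemma lab_bounded k (w : word k) : bounded k (lab w).
Proof.
move=> s lt_ns; have lt_i : (s - n.+1 < n)%N by have := ltn_ord s; lia.
have -> : s = snat n (Ordinal lt_i).+1.
  by apply: ord_inj; rewrite val_snat //=; lia.
by rewrite lab_snat; have := ltn_ord (w (Ordinal lt_i)); lia.
Qed.

Lemma lab_inj k (w w' : word k) : lab w =1 lab w' -> w = w'.
Proof.
move=> eq_ww'; apply/ffunP => i; apply: ord_inj.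
by have := eq_ww' (snat n i.+1); rewrite !lab_snat => /addIr[].
Qed.

Lemma lab_exists k F : odd_fun F -> bounded k F -> exists w : word k, lab w =1 F.
Proof.
move=> Fodd Fk.
have /fin_all_exists[f fP] (i : 'I_n) :
    exists a : 'I_k.*2, F (snat n i.+1) = a%:Z - k%:Z.
  have := Fk (snat n i.+1); rewrite val_snat // => /(_ _)/wrap[]; first by lia.
  move=> Fi; have lt_a : (absz (F (snat n i.+1) + k%:Z)%R < k.*2)%N by lia.
  by exists (Ordinal lt_a) => /=; lia.
exists (finfun f); apply: odd_fun_eq => // [|j lt_jn]; first exact: lab_odd.
by rewrite (lab_snat _ (Ordinal lt_jn)) ffunE -fP.
Qed.

(** The standardization of [F]; the default [1] never occurs for odd [F]. *)
Definition std F : hyperoct n := odflt 1%g [pick p | sorts F p].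

Lemma stdP F : odd_fun F -> sorts F (std F).
Proof.
move=> /sorts_exists[p Fp]; rewrite /std.
by case: pickP => //= /(_ p); rewrite Fp.
Qed.

Lemma std_eq F p : odd_fun F -> (std F == p) = sorts F p.
Proof.
move=> Fodd; apply/eqP/idP => [<-|]; first exact: stdP.
exact/sorts_uniq/stdP.
Qed.

Lemma bounded_le k F s : odd_fun F -> bounded k F -> - k%:Z <= F s <= k%:Z.
Proof.
move=> Fodd Fk; case: (ltngtP n s) => [/Fk|lt_sn|eq_ns]; first by lia.
- have := Fk (sopp s); rewrite Fodd val_sopp => /(_ _)/wrap[]; lia.
- have -> : s = snat n 0 by apply: ord_inj; rewrite val_snat; lia.
  by rewrite odd_fun0 //; lia.
Qed.

(** The bound excludes k at positive arguments, and oddness gives F(0) = 0 < k. *)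
Lemma bounded_max k F s : (0 < k)%N -> odd_fun F -> bounded k F -> F s = k%:Z -> (s < n)%N.
Proof.
move=> k_gt0 Fodd Fk Fs; rewrite ltnNge leq_eqVlt; apply/negP => /orP[/eqP eq_ns|/Fk]; last by lia.
move: Fs; have -> : s = snat n 0 by apply: ord_inj; rewrite val_snat; lia.
by rewrite odd_fun0 //; lia.
Qed.

Lemma bounded_min k F s : (0 < k)%N -> odd_fun F -> bounded k F -> F s = - k%:Z -> (n < s)%N.
Proof.
move=> k_gt0 Fodd Fk Fs.
have := bounded_max k_gt0 Fodd Fk (s := sopp s); rewrite Fodd val_sopp Fs opprK => /(_ erefl).
by have := ltn_ord s; lia.
Qed.

(** * Combining two odd functions into one *)

Section Product.

Variables (k l : nat) (F G : spt n -> int).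
Hypotheses (k_gt0 : (0 < k)%N) (l_gt0 : (0 < l)%N).
Hypotheses (Fodd : odd_fun F) (Godd : odd_fun G).
Hypotheses (Fk : bounded k F) (Gl : bounded l G).

(* F takes the value k only at negative arguments and -k only at positive
   ones, so when consecutive values of G collide in labM the tie is still
   broken correctly by the order of the arguments. *)
Definition labM s : int := k.*2%:Z * G ((std F)^-1%g s) + F s.

Lemma labM_odd : odd_fun labM.
Proof. by move=> s; rewrite /labM hyperoct_opp Godd Fodd mulrN opprD. Qed.

Lemma klt_labM s t : klt G s t -> klt labM (std F s) (std F t).
Proof.
clear l_gt0; have Fs := bounded_le (std F s) Fodd Fk; have Ft := bounded_le (std F t) Fodd Fk.
have Fs' := bounded_max k_gt0 Fodd Fk (s := std F s).
have Ft' := bounded_min k_gt0 Fodd Fk (s := std F t).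
rewrite /klt /labM !hyperoctKV => /orP[lt_G|/andP[/eqP-> /(sortsP _ _ (stdP Fodd))]].
  (* A rise of [G] by at least 1 makes up for any drop of [F], which is at most 2k; a tie requires
     the drop from k to -k. *)
  have : k.*2%:Z * G s + k.*2%:Z <= k.*2%:Z * G t by nia.
  move: (_ * G s) (_ * G t) => a b; lia.
rewrite /klt; move: (_ * G t) => a; lia.
Qed.

Lemma std_labM : std labM = (std F * std G)%g.
Proof.
apply/eqP; rewrite std_eq; last exact: labM_odd.
apply/sortsP => s t lt_st; rewrite !hmulE.
exact/klt_labM/(sortsP _ _ (stdP Godd)).
Qed.

(** Only G(u) = l or -l could leave the range. The first forces [u] negative, hence F(s) < 0 by
    sorting; the second forces [u] positive, hence F(s) >= 0. *)
Lemma labM_bounded : bounded (2 * k * l) labM.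
Proof.
move=> s lt_ns; rewrite /labM; set u := ((std F)^-1)%g s.
have Fs := Fk lt_ns; have Gu := bounded_le u Godd Gl.
have Gmax := bounded_max l_gt0 Godd Gl (s := u).
have Gmin := bounded_min l_gt0 Godd Gl (s := u).
have F0 := odd_fun0 Fodd.
have Fu_lt : (u < n)%N -> F s < 0.
  move=> lt_un; have := sortsP _ _ (stdP Fodd) u (snat n 0).
  by rewrite val_snat // hyperoctVK hyperoct_snat0 /klt F0 val_snat //; lia.
have Fu_gt : (n < u)%N -> 0 <= F s.
  move=> lt_nu; have := sortsP _ _ (stdP Fodd) (snat n 0) u.
  by rewrite val_snat // hyperoctVK hyperoct_snat0 /klt F0 val_snat //; lia.
have [Gu_eq|] := eqVneq (G u) l; first by rewrite Gu_eq; have := Fu_lt (Gmax Gu_eq); nia.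
have [Gu_eq|] := eqVneq (G u) (- l%:Z); first by rewrite Gu_eq; have := Fu_gt (Gmin Gu_eq); nia.
nia.
Qed.

End Product.

End Words.

(** * Sums of sorting permutations in the group algebra *)

Section GroupAlgebraSums.

Variable n : nat.

Definition wsum k : QB n := \sum_(w : word n k) gbase rat (std (lab w)).

Lemma wsumM k l : (0 < k)%N -> (0 < l)%N -> wsum k * wsum l = wsum (2 * k * l).
Proof.
move=> k_gt0 l_gt0.
have /fin_all_exists[f fP] (ww : word n k * word n l) :
    exists w : word n (2 * k * l), lab w =1 labM k (lab ww.1) (lab ww.2).
  apply: lab_exists; first by apply: labM_odd; apply: lab_odd.
  by apply: labM_bounded => //; [apply: lab_odd..|apply: lab_bounded|apply: lab_bounded].
have f_inj : injective f.
  move=> [w1 w2] [w1' w2'] eq_f.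
  have eqM s : labM k (lab w1) (lab w2) s = labM k (lab w1') (lab w2') s.
    by rewrite -(fP (w1, w2)) -(fP (w1', w2')) eq_f.
  have eq1 : w1 = w1'.
    apply: lab_inj; apply: odd_fun_eq; [exact: lab_odd|exact: lab_odd|move=> j lt_jn].
    have lt_n : (n < snat n j.+1)%N by rewrite val_snat //; lia.
    have := lab_bounded w1 lt_n; have := lab_bounded w1' lt_n.
    have := eqM (snat n j.+1); rewrite /labM.
    move: (lab w1 _) (lab w1' _) (lab w2 _) (lab w2' _) => a b c d eq_ab b_k a_k.
    (* [a] and [b] lie in a common window of length 2k, so they cannot make up for a difference of
       2k or more. *)
    have [lt_cd|lt_dc|eq_cd] := ltgtP c d; last by lia.
      have : k.*2%:Z * c + k.*2%:Z <= k.*2%:Z * d by nia.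
      by move: (_ * c) (_ * d) eq_ab => u v; lia.
    have : k.*2%:Z * d + k.*2%:Z <= k.*2%:Z * c by nia.
    by move: (_ * c) (_ * d) eq_ab => u v; lia.
  (* With the remainders equal, cancelling 2k recovers the second word. *)
  subst w1'; congr (_, _); apply: lab_inj => s.
  have := eqM (std (lab w1) s); rewrite /labM hyperoctKV => /addIr.
  by apply: mulfI; rewrite eqz_nat double_eq0 -lt0n.
have f_bij : bijective f.
  (* Both sides have (2k)^n (2l)^n = (4kl)^n elements. *)
  apply: inj_card_bij => //; rewrite card_prod !card_ffun !card_ord -expnMn.
  by apply/eq_leq; congr (_ ^ _)%N; lia.
rewrite /wsum big_distrlr /= pair_bigA (reindex f) /=; last exact/onW_bij.
apply: eq_bigr => ww _; rewrite -gbaseM; congr (gbase _ _).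
rewrite -(std_labM k_gt0 (lab_odd ww.1) (lab_odd ww.2) (lab_bounded ww.1)).
apply/esym/eqP; rewrite std_eq; last exact: lab_odd.
have := stdP (labM_odd k (lab_odd ww.1) (lab_odd ww.2)).
by move=> /sortsP H; apply/sortsP => s t /H; rewrite /klt !fP.
Qed.

(** * Counting the words sorted by a given permutation *)

Section Count.

Variables (k : nat) (p : hyperoct n).
Hypothesis k_gt0 : (0 < k)%N.

Let des j : nat := \sum_(i < j) is_ades p i.

Lemma desS j : des j.+1 = (des j + is_ades p j)%N.
Proof. by rewrite /des big_ord_recr. Qed.

Lemma ades_des : ades p = (des n + is_ades p n)%N.
Proof.
rewrite -desS /des /ades -sum1_card big_mkcond /=.
by apply: eq_bigr => i _; rewrite inE; case: is_ades.
Qed.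

Lemma ades_le : (ades p <= n.+1)%N.
Proof. by rewrite -[X in (_ <= X)%N]card_ord; apply: max_card. Qed.

(** Tied values are ordered by argument, so equality is allowed exactly at the non-descents. *)
Lemma klt_ades F i : (i < n)%N ->
  klt F (p (snat n i)) (p (snat n i.+1)) =
  (F (p (snat n i)) + (is_ades p i)%:Z <= F (p (snat n i.+1))).
Proof.
move=> lt_in; rewrite /is_ades lt_in /klt /sint.
have : p (snat n i) != p (snat n i.+1) :> nat.
  rewrite (inj_eq (@ord_inj _)) (inj_eq perm_inj) -(inj_eq (@ord_inj _)).
  by rewrite (val_snat lt_in) (val_snat (ltnW lt_in)); lia.
by move: (F _) (F _) (nat_of_ord _) (nat_of_ord _) => a b c d; lia.
Qed.

Lemma sorts_le F (s t : spt n) : sorts F p -> (s <= t)%N -> F (p s) <= F (p t).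
Proof.
move=> /sortsP Fp; rewrite leq_eqVlt => /orP[/eqP/ord_inj-> //|/Fp].
by rewrite /klt; lia.
Qed.

(** The value at position n is the largest on positions 0, ..., n. A positive argument there with
    value k would tie with it and hence force [top] to be positive, which is the augmented descent
    at n. *)
Lemma bounded_ades F : odd_fun F -> sorts F p ->
  bounded k F <-> F (p (snat n n)) + (is_ades p n)%:Z <= k%:Z.
Proof.
move=> Fodd Fp; rewrite /is_ades ltnn /sint; set top := p (snat n n).
split=> [Fk|le_k s lt_ns].
  have := bounded_le top Fodd Fk; have := Fk top; lia.
rewrite -(hyperoctVK p s) in lt_ns *; set u := (p^-1)%g s in lt_ns *.
have Fle := fun v w : spt n => @sorts_le F v w Fp.
have F0 : F (p (snat n 0)) = 0 by rewrite hyperoct_snat0 odd_fun0.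
case: (spt_cases u) lt_ns => [[j le_jn ->]|[j lt_jn ->]] lt_ns.
  have := Fle (snat n 0) (snat n j); rewrite !val_snat // F0.
  have := Fle (snat n j) (snat n n); rewrite !val_snat //.
  move: lt_ns; have [->|ne_jn] := eqVneq j n => lt_ns.
    by move: lt_ns le_k; rewrite -/top; lia.
  have := sortsP _ _ Fp (snat n j) (snat n n); rewrite !val_snat // /klt -/top.
  move: lt_ns le_k; lia.
have := Fle (snat n 0) (snat n j.+1); rewrite !val_snat // F0.
have := Fle (snat n j.+1) (snat n n); rewrite !val_snat // -/top.
rewrite hyperoct_opp Fodd; move: le_k; lia.
Qed.

Lemma card_std :
  #|[set w : word n k | std (lab w) == p]| = 'C(k + n - ades p, n).
Proof.
set N := (k + n - ades p)%N; rewrite -card_ltn_sorted_tuples.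
(* Index [j] stands for position j + 1, so the shift is [j], and [des j.+1] includes a possible
   descent at 0. *)
apply: (@card_eq_rel _ _ _ _ (fun (w : word n k) (b : n.-tuple 'I_N) =>
  forall j, (j < n)%N -> lab w (p (snat n j.+1)) + j%:Z =
    (nth 0%N [seq val i | i <- b] j)%:Z + (des j.+1)%:Z)).
- move=> w; rewrite inE std_eq; last exact: lab_odd.
  set F := lab w => Fp; have Fodd : odd_fun F := lab_odd w.
  have Ftop := (bounded_ades Fodd Fp).1 (lab_bounded w).
  (* Passing from F to e turns the strict steps at descents into weak ones. *)
  pose e j := F (p (snat n j)) - (des j)%:Z.
  have e0 : e 0%N = 0 by rewrite /e hyperoct_snat0 odd_fun0 // /des big_ord0.
  have eS j : (j < n)%N -> e j <= e j.+1.
    move=> lt_jn; have := sortsP _ _ Fp (snat n j) (snat n j.+1).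
    by rewrite klt_ades // (val_snat lt_jn) (val_snat (ltnW lt_jn)) /e desS; lia.
  have e_mono i j : (i <= j)%N -> (j <= n)%N -> e i <= e j.
    elim: j => [|j IHj]; first by rewrite leqn0 => /eqP->.
    rewrite leq_eqVlt => /orP[/eqP-> //|lt_ij lt_jn].
    by apply: le_trans (eS _ lt_jn); apply: IHj => //; apply: ltnW.
  have en : e n <= k%:Z - (ades p)%:Z by rewrite ades_des /e; lia.
  have /fin_all_exists[b bP] (i : 'I_n) : exists c : 'I_N, c%:Z = e i.+1 + i%:Z.
    have := e_mono 0%N i.+1; have := e_mono i.+1 n; have := ltn_ord i.
    rewrite e0 => lt_in /(_ lt_in (leqnn _)) le1 /(_ isT lt_in) le2.
    have lt_c : (absz (e i.+1 + i%:Z)%R < N)%N by rewrite /N; lia.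
    by exists (Ordinal lt_c) => /=; lia.
  have nthb j : (j < n)%N ->
      (nth 0%N [seq val i | i <- [tuple b i | i < n]] j)%:Z = e j.+1 + j%:Z.
    move=> lt_jn; rewrite -[j]/(val (Ordinal lt_jn)).
    by rewrite (nth_map (b (Ordinal lt_jn))) ?size_tuple // -tnth_nth tnth_mktuple bP.
  exists [tuple b i | i < n] => [|j lt_jn].
    rewrite inE; apply/(sortedP 0%N) => j; rewrite size_map size_tuple => lt_jn.
    have := nthb _ lt_jn; have := nthb j (ltnW lt_jn); have := eS _ lt_jn.
    by move: (nth _ _ j) (nth _ _ j.+1) => c d /=; lia.
  rewrite nthb // /e; lia.
- move=> b; rewrite inE => /(sortedP 0%N); rewrite size_map size_tuple => b_lt.
  set B := nth 0%N _ in b_lt *.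
  have B_lt j : (j < n)%N -> (B j < N)%N.
    move=> lt_jn; rewrite /B (nth_map (tnth b (Ordinal lt_jn))) ?size_tuple //.
    exact: ltn_ord.
  (* Undo both shifts, extend oddly in the positions, and carry the result over to the points by
     [p]. *)
  pose a j := (B j)%:Z + (des j.+1)%:Z - j%:Z.
  pose F s := oddext a ((p^-1)%g s).
  have Fodd : odd_fun F by move=> s; rewrite /F hyperoct_opp oddext_odd.
  have Fp0 : F (p (snat n 0)) = 0 by rewrite hyperoct_snat0 odd_fun0.
  have FpS j : (j < n)%N -> F (p (snat n j.+1)) = a j.
    by move=> lt_jn; rewrite /F hyperoctKV oddext_snat.
  have Fp : sorts F p.
    apply: sorts_nat => // i lt_in; rewrite klt_ades // FpS // /a desS.
    case: i lt_in => [|i] lt_in; first by rewrite Fp0; lia.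
    have := b_lt i lt_in; rewrite FpS 1?ltnW // /a; lia.
  have Fk : bounded k F.
    apply/bounded_ades => //; have [n0|n_gt0] := posnP n.
      have -> : snat n n = snat n 0 by congr (snat n _).
      by rewrite Fp0; case: is_ades; lia.
    have := FpS n.-1; rewrite /a prednK // leqnn => -> //.
    have := B_lt n.-1; rewrite prednK // leqnn => /(_ isT).
    by have := ades_des; rewrite /N; lia.
  have [w wF] := lab_exists Fodd Fk.
  exists w => [|j lt_jn]; last by rewrite wF FpS // /a; lia.
  rewrite inE std_eq; last exact: lab_odd.
  by apply/sortsP => s t /(sortsP _ _ Fp); rewrite /klt !wF.
- move=> w b b' wb wb'; apply: eq_from_tnth => j; apply: ord_inj.
  have := wb j (ltn_ord j); rewrite (wb' j (ltn_ord j)) => /addIr[].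
  by rewrite !(nth_map (tnth b j)) ?size_tuple // -!tnth_nth.
- move=> w w' b wb w'b; apply: lab_inj => s; rewrite -(hyperoctVK p s).
  move: ((p^-1)%g s) => {}s.
  apply: (@odd_fun_eq _ (fun u => lab w (p u)) (fun u => lab w' (p u))) => [u|u|j lt_jn].
  + by rewrite hyperoct_opp lab_odd.
  + by rewrite hyperoct_opp lab_odd.
  + by have := wb j lt_jn; rewrite -(w'b j lt_jn) => /addIr.
Qed.

End Count.

Lemma wsumE k : (0 < k)%N ->
  wsum k = \sum_(p : hyperoct n) 'C(k + n - ades p, n)%:R *: gbase rat p.
Proof.
move=> k_gt0; rewrite /wsum (partition_big (fun w => std (lab w)) predT) //=.
apply: eq_bigr => p _; under eq_bigr => w /eqP-> do [].
rewrite -card_std // sumr_const scaler_nat; congr (_ *+ _).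
by apply: eq_card => w; rewrite inE.
Qed.

End GroupAlgebraSums.

(** * Binomial polynomials at natural numbers *)

Lemma natr_ffact (R : comNzRingType) N m :
  (N ^_ m)%:R = \prod_(i < m) (N%:R - i%:R) :> R.
Proof.
elim: m => [|m IHm]; first by rewrite big_ord0.
rewrite big_ord_recr -IHm ffactnSr natrM /=.
by have [le_mN|lt_Nm] := leqP m N; [rewrite natrB|rewrite ffact_small ?mul0r].
Qed.

Lemma horner_pbinom (q : {poly rat}) x m N :
  q.[x] = N%:R -> (pbinom q m).[x] = 'C(N, m)%:R.
Proof.
move=> qx; rewrite /pbinom hornerZ horner_prod.
under eq_bigr do rewrite hornerD hornerN -polyC_natr hornerC qx.
rewrite -natr_ffact -bin_ffact natrM mulrC mulfK //.
by rewrite pnatr_eq0 -lt0n fact_gt0.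
Qed.

(** * Evaluation at natural numbers over a noncommutative ring *)

Section NatEval.

Variable R : nzRingType.

Lemma comm_natr k : commr_rmorph (@idfun R) k%:R.
Proof. by move=> x; apply/commr_sym/commr_nat. Qed.

Definition nat_eval k : {rmorphism {poly R} -> R} := horner_morph (comm_natr k).

Lemma nat_evalE k p : nat_eval k p = p.[k%:R].
Proof. by rewrite /= /horner_morph map_poly_id. Qed.

(* R need not be commutative, nor its units computable, which rules out
   max_ring_poly_roots; natural numbers are central, so linear factors can be
   split off one at a time. *)
Lemma nat_eval_eq0 (p : {poly R}) :
    (forall (x : R) m, x *+ m.+1 = 0 -> x = 0) ->
  (forall k, (0 < k)%N -> nat_eval k.*2 p = 0) -> p = 0.
Proof.
move=> R_tf.
(* Raising [M] discards the evaluation points already used as roots. *)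
suff H m M : (size p <= m)%N ->
    (forall k, (M < k)%N -> nat_eval k.*2 p = 0) -> p = 0.
  exact: H.
elim: m p M => [|m IHm] p M; first by rewrite leqn0 size_poly_eq0 => /eqP.
move=> le_pm pM; have /factor_theorem[q Dp] : root p (M.+1.*2)%:R.
  by apply/rootP; rewrite -nat_evalE pM.
have [q0|q_neq0] := eqVneq q 0; first by rewrite Dp q0 mul0r.
suff q0 : q = 0 by rewrite Dp q0 mul0r.
apply: (IHm _ M.+1) => [|k lt_Mk].
  by move: le_pm; rewrite Dp size_Mmonic ?monicXsubC // size_XsubC addn2.
have := pM k (ltnW lt_Mk); rewrite Dp rmorphM /= !nat_evalE hornerXsubC.
rewrite -natrB; last by lia.
(* The factor 2k - 2(M + 1) is a positive natural number, so torsion-freeness cancels it. *)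
rewrite mulr_natr (_ : (_ - _)%N = (k - M.+2).*2.+1.+1); last by lia.
exact: R_tf.
Qed.

End NatEval.

(** * Evaluating identities in x and y at pairs of natural numbers *)

Section PsiEval.

Variable n : nat.

Lemma psi_nat k : (0 < k)%N -> (psi n).[k%:R] = wsum n k.
Proof.
move=> k_gt0; rewrite wsumE // -nat_evalE /psi rmorph_sum; apply: eq_bigr => p _.
rewrite rmorphM !nat_evalE hornerC -(rmorph_nat (in_alg (QB n))) horner_map.
rewrite (@horner_pbinom _ _ _ (k + n - ades p)) ?mulr_algl //.
rewrite !hornerE -!polyC_natr !hornerC natrB ?natrD //.
(* As ades(p) <= n + 1 <= k + n, the natural subtraction is not truncated. *)
by have := ades_le p; lia.
Qed.

(** The outer variable y becomes l first, then x becomes k. *)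
Definition eval2 k l : {rmorphism {poly {poly QB n}} -> QB n} :=
  nat_eval (QB n) k \o nat_eval {poly QB n} l.

Lemma eval2_psi_at k l t : eval2 k l (psi_at t) = (psi n).[eval2 k l t].
Proof.
rewrite /psi_at -horner_map -!map_poly_comp map_poly_id // => c _.
by rewrite /= !nat_evalE !hornerC.
Qed.

Lemma eval2_inj (P Q : {poly {poly QB n}}) :
    (forall k l, (0 < k)%N -> (0 < l)%N -> eval2 k.*2 l.*2 P = eval2 k.*2 l.*2 Q) ->
  P = Q.
Proof.
have tf (x : QB n) m : x *+ m.+1 = 0 -> x = 0.
  by rewrite -scaler_nat => /eqP; rewrite scaler_eq0 pnatr_eq0 => /eqP.
have tfX (p : {poly QB n}) m : p *+ m.+1 = 0 -> p = 0.
  move=> pm0; apply/polyP => i; rewrite coef0; apply: (tf _ m).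
  by rewrite -coefMn pm0 coef0.
move=> PQ; apply/eqP; rewrite -subr_eq0; apply/eqP.
apply: nat_eval_eq0 => // l l_gt0; apply: nat_eval_eq0 => // k k_gt0.
by apply/eqP; rewrite !rmorphB subr_eq0; apply/eqP/PQ.
Qed.

Lemma eval2_X k l : eval2 k l 'X%:P = k%:R.
Proof. by rewrite /= !nat_evalE hornerC hornerX. Qed.

Lemma eval2_Y k l : eval2 k l 'X = l%:R.
Proof. by rewrite /= !nat_evalE hornerX -polyC_natr hornerC. Qed.

End PsiEval.

Theorem theorem1p4 (n : nat) (n_gt0 : (0 < n)%N) :
  let x : {poly {poly QB n}} := 'X%:P in
  let y : {poly {poly QB n}} := 'X in
  let half : {poly {poly QB n}} := ((2%:R^-1 : rat)%:A)%:P%:P in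
  psi_at x * psi_at y = psi_at (2%:R * x * y) /\
  psi_at (half * x) * psi_at (half * y) = psi_at (half * (x * y)).
Proof.
move=> x y half.
have halfE k l m : eval2 n k l half * m.*2%:R = m%:R.
  rewrite /half /= !nat_evalE !hornerC mulr_algl -muln2 natrM mulr_natr.
  by rewrite -scaler_nat scalerA mulVf ?scale1r.
split; apply: eval2_inj => k l k_gt0 l_gt0; rewrite rmorphM !eval2_psi_at !rmorphM.
- rewrite eval2_X eval2_Y rmorph_nat -!natrM !psi_nat ?muln_gt0 ?double_gt0 ?k_gt0 //.
  by rewrite wsumM ?double_gt0.
- rewrite eval2_X eval2_Y !halfE -natrM.
  (* At x = 2k and y = 2l, the halves are k and l, and xy/2 is 2kl. *)
  rewrite (_ : (k.*2 * l.*2 = (2 * k * l).*2)%N); last by lia.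
  by rewrite halfE !psi_nat ?muln_gt0 ?k_gt0 // wsumM.
Qed.
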